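(* Let $\mathcal{A}$ be an assessment on $\mathcal{L}$. Then $\mathcal{A}$ is deductively closable if and only if its set of maximal dominating models is non-empty, i.e., if and only if $\hat{\mathbb{M}}_{\mathcal{A}}\neq\emptyset$.
   Context: Let $\Omega$ be a non-empty set and let $\mathcal{L}$ be a real linear subspace of the vector space of all real-valued functions (''gambles'') on $\Omega$ with pointwise operations. For $\mathcal{K},\mathcal{K}'\subseteq\mathcal{L}$: $-\mathcal{K}=\{-f:f\in\mathcal{K}\}$; $\mathcal{K}+\mathcal{K}'=\{f+g:f\in\mathcal{K},g\in\mathcal{K}'\}$ (so $\mathcal{K}+\emptyset=\emptyset$); $\mathcal{K}-\mathcal{K}'=\mathcal{K}+(-\mathcal{K}')$; $\overline{\mathcal{K}}=\{\lambda f:\lambda>0,f\in\mathcal{K}\}$; $\operatorname{posi}\mathcal{K}$ is the set of all linear combinations with strictly positive coefficients of non-empty finite families of elements of $\mathcal{K}$ (so $\operatorname{posi}\emptyset=\emptyset$). A cone is a set $\mathcal{K}\subseteq\mathcal{L}$ with $\operatorname{posi}\mathcal{K}=\mathcal{K}$. An assessment is a pair $\mathcal{A}=\langle\mathcal{A}_{\mathrm{acc}};\mathcal{A}_{\mathrm{rej}}\rangle$ of subsets of $\mathcal{L}$ (accepted and rejected gambles). Inclusion between assessments is component-wise; $\mathcal{B}$ dominates $\mathcal{A}$ if $\mathcal{A}\subseteq\mathcal{B}$. An assessment is without confusion if $\mathcal{A}_{\mathrm{acc}}\cap\mathcal{A}_{\mathrm{rej}}=\emptyset$. An assessment $\mathcal{A}$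 is deductively closable if it is without confusion and its deductive extension $\langle\operatorname{posi}\mathcal{A}_{\mathrm{acc}};\mathcal{A}_{\mathrm{rej}}\rangle$ is also without confusion. A model without confusion is an assessment $\mathcal{M}$ such that $\mathcal{M}_{\mathrm{acc}}\cap\mathcal{M}_{\mathrm{rej}}=\emptyset$, $\mathcal{M}_{\mathrm{acc}}$ is a cone, and $\overline{\mathcal{M}_{\mathrm{rej}}}\cup(\overline{\mathcal{M}_{\mathrm{rej}}}-\mathcal{M}_{\mathrm{acc}})\subseteq\mathcal{M}_{\mathrm{rej}}$. The set of these is $\mathbb{M}$; $\hat{\mathbb{M}}$ is the set of maximal elements of the poset $(\mathbb{M},\subseteq)$, and $\hat{\mathbb{M}}_{\mathcal{A}}=\{\mathcal{M}\in\hat{\mathbb{M}}:\mathcal{A}\subseteq\mathcal{M}\}$. *)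

(* Defs.v *)
From mathcomp Require Import all_boot all_order all_algebra.
From mathcomp Require Import all_classical all_reals.

Set Implicit Arguments.
Unset Strict Implicit.
Unset Printing Implicit Defensive.

Import Order.TTheory GRing.Theory Num.Theory.

Local Open Scope classical_set_scope.
Local Open Scope ring_scope.

(* The codomain of gambles is written [R^o], i.e. R as a module over itself,
   so that functions Omega -> R^o inherit the pointwise lmodType R structure. *)
Section Gambles.
Variables (R : realType) (Omega : Type).
Implicit Types K : set (Omega -> R^o).

Definition set_opp K : set (Omega -> R^o) := [set - f | f in K].

Definition set_add K K' : set (Omega -> R^o) := [set f + g | f in K & g in K'].

Definition set_sub K K' : set (Omega -> R^o) := set_add K (set_opp K').

Definition ray_hull K : set (Omega -> R^o) :=
  [set h | exists lambda : R, exists f, [/\ 0 < lambda, K f & h = lambda *: f]].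

Definition posi K : set (Omega -> R^o) :=
  [set h | exists (n : nat) (c : 'I_n -> R) (f : 'I_n -> (Omega -> R^o)),
    [/\ (0 < n)%N, forall i, 0 < c i, forall i, K (f i)
      & h = \sum_(i < n) c i *: f i]].

Record assessment := Assessment {
  acc : set (Omega -> R^o);
  rej : set (Omega -> R^o) }.

Implicit Types (L : set (Omega -> R^o)) (A B M N : assessment).

Definition assessment_on L A : Prop := acc A `<=` L /\ rej A `<=` L.

(* Argument order: B dominates A when A is included in B componentwise. *)
Definition dominates B A : Prop := acc A `<=` acc B /\ rej A `<=` rej B.

Definition without_confusion A : Prop := acc A `&` rej A = set0.

Definition deductive_extension A : assessment :=
  Assessment (posi (acc A)) (rej A).

Definition deductively_closable A : Prop :=
  without_confusion A /\ without_confusion (deductive_extension A).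

Definition is_cone L K : Prop := K `<=` L /\ posi K = K.

Definition models L : set assessment :=
  [set M | [/\ assessment_on L M, without_confusion M, is_cone L (acc M)
    & ray_hull (rej M) `|` set_sub (ray_hull (rej M)) (acc M) `<=` rej M]].

Definition maximal_models L : set assessment :=
  [set M | models L M /\ forall N, models L N -> dominates N M -> N = M].

Definition maximal_dominating_models L A : set assessment :=
  [set M | maximal_models L M /\ dominates M A].

End Gambles.

(* Main.v *)
Require Import Defs.
From mathcomp Require Import all_boot all_order all_algebra.
From mathcomp Require Import all_classical all_reals.

(** The key observation is that every cone [K] of gambles in [L] is the accept
    part of a maximal model, namely the pair of [K] and its relative complement
    [L `\` K].  This pair is a model: if [r] lies in [L] but not in [K], then
    neither a positive multiple [c *: r] nor a difference [c *: r - k] with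
    [k] in [K] can lie in [K], because [r] would then be recovered from it by
    addition of [k] and positive scaling.  It is maximal because it
    already partitions [L], so that any larger model on [L] would be confused.

    If [A] is deductively closable, apply this to [K = posi (acc A)], which is
    the least cone containing [acc A] and is disjoint from [rej A]; no appeal to
    Zorn's lemma is needed.  Conversely, if a model [M] dominates [A], then
    [posi (acc A)] is included in [posi (acc M) = acc M], which is disjoint from
    [rej M] and hence from [rej A]. *)

Import Order.TTheory GRing.Theory Num.Theory.

Local Open Scope classical_set_scope.
Local Open Scope ring_scope.

Section PositiveHull.
Context {R : realType} {Omega : Type}.
Implicit Types (K : set (Omega -> R^o)) (f g : Omega -> R^o).

Lemma sub_posi K : K `<=` posi K.
Proof.
move=> f Kf; exists 1%N, (fun=> 1), (fun=> f); split => //.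
by rewrite big_ord1 scale1r.
Qed.

Lemma posi_mono K K' : K `<=` K' -> posi K `<=` posi K'.
Proof.
by move=> KK' h [n [c [f [n0 c0 Kf ->]]]]; exists n, c, f; split => // i; exact: KK'.
Qed.

Lemma posiZ K (a : R) f : 0 < a -> posi K f -> posi K (a *: f).
Proof.
move=> a0 [n [c [g [n0 c0 Kg ->]]]].
exists n, (fun i => a * c i), g; split => // [i|]; first exact: mulr_gt0.
by rewrite scaler_sumr; apply: eq_bigr => i _; rewrite scalerA.
Qed.

Lemma posiD K f g : posi K f -> posi K g -> posi K (f + g).
Proof.
move=> [n [c [u [n0 c0 Ku ->]]]] [m [d [v [_ d0 Kv ->]]]].
exists (n + m)%N,
  (fun i => match fintype.split i with inl j => c j | inr j => d j end),
  (fun i => match fintype.split i with inl j => u j | inr j => v j end).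
split => [|i|i|]; first by rewrite addn_gt0 n0.
- by case: fintype.split.
- by case: fintype.split.
rewrite big_split_ord; congr (_ + _); apply: eq_bigr => i _.
  by rewrite -[lshift m i]/(unsplit (inl i)) unsplitK.
by rewrite -[rshift n i]/(unsplit (inr i)) unsplitK.
Qed.

(** Sets closed under addition and positive scaling are closed under [posi].
    Such a set need not contain [0], so the induction starts from a sum with a
    single term. *)
Lemma posi_sub_closed K :
    (forall (a : R) f, 0 < a -> K f -> K (a *: f)) ->
    (forall f g, K f -> K g -> K (f + g)) ->
  posi K `<=` K.
Proof.
move=> KZ KD _ [n [c [f [n0 c0 Kf ->]]]].
case: n n0 c f c0 Kf => // n _; elim: n => [|n IHn] c f c0 Kf.
  by rewrite big_ord1; exact: KZ.
by rewrite big_ord_recr; apply: KD; [exact: IHn | exact: KZ].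
Qed.

Lemma posi_id K : posi (posi K) = posi K.
Proof.
apply/seteqP; split; last exact: sub_posi.
by apply: posi_sub_closed; [exact: posiZ | exact: posiD].
Qed.

End PositiveHull.

Section MaximalModels.
Context {R : realType} {Omega : Type} (L : set (Omega -> R^o)).
Context (L_subspace : submod_closed (mem L)).
Implicit Types (K : set (Omega -> R^o)) (f g : Omega -> R^o).

Lemma subspaceZD (a : R) f g : L f -> L g -> L (a *: f + g).
Proof.
case: L_subspace => _ Llin Lf Lg.
by have := Llin a f g; rewrite !inE; apply.
Qed.

Lemma subspaceZ (a : R) f : L f -> L (a *: f).
Proof.
have L0 : L 0 by case: L_subspace => + _; rewrite inE.
by move=> Lf; rewrite -[a *: f]addr0; exact: subspaceZD.
Qed.

Lemma posi_cone K : K `<=` L -> is_cone L (posi K).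
Proof.
move=> KL; split; last exact: posi_id.
move=> h /(posi_mono _ _ KL); apply: posi_sub_closed => [a f _|f g Lf Lg].
  exact: subspaceZ.
by rewrite -[f]scale1r; exact: subspaceZD.
Qed.

(** A cone together with its relative complement is a model. *)
Lemma cone_model K : is_cone L K -> models L (Assessment K (L `\` K)).
Proof.
move=> coneK; case: (coneK) => KL KE.
have KZ (a : R) f : 0 < a -> K f -> K (a *: f).
  by rewrite -KE; exact: posiZ.
have KD f g : K f -> K g -> K (f + g) by rewrite -KE; exact: posiD.
have notKZ (a : R) f : 0 < a -> ~ K f -> ~ K (a *: f).
  move=> a0 + Kaf; apply; rewrite -[f]scale1r -(mulVf (lt0r_neq0 a0)) -scalerA.
  by apply: KZ; rewrite ?invr_gt0.
split => //=.
- by split => //= f [].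
- by apply/seteqP; split => // f [] /= Kf [].
move=> h [[a [f [a0 [Lf nKf] ->]]]|].
  by split; [exact: subspaceZ | exact: notKZ].
move=> [_ [a [f [a0 [Lf nKf] ->]]] [_ [k Kk <-] <-]]; split.
  by apply: subspaceZD => //; rewrite -scaleN1r; apply/subspaceZ/KL.
move=> Kh; apply: (notKZ a f a0 nKf).
by rewrite -[a *: f](subrK k); exact: KD.
Qed.

Lemma cone_maximal_model K :
  is_cone L K -> maximal_models L (Assessment K (L `\` K)).
Proof.
move=> coneK; split; first exact: cone_model.
move=> [Na Nr] [[/= NaL NrL] /= Nconf _ _] [/= KNa LKNr].
have Ndisj f : Na f -> Nr f -> False.
  by move=> Naf Nrf; suff: set0 f by []; rewrite -Nconf.
congr Assessment; apply/seteqP; split => // f Nf.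
  by apply: contrapT => nKf; apply: (Ndisj f) => //; apply: LKNr; split => //; exact: NaL.
by split; [exact: NrL | move=> Kf; apply: (Ndisj f) => //; exact: KNa].
Qed.

End MaximalModels.

Theorem theorem2p16 (R : realType) (Omega : Type) (Omega_neq0 : [set: Omega] !=set0)
    (L : set (Omega -> R^o)) (L_subspace : submod_closed (mem L))
    (A : assessment R Omega) (A_on_L : assessment_on L A) :
  deductively_closable A <-> maximal_dominating_models L A !=set0.
Proof.
case: A_on_L => AaL ArL; split.
  move=> [_ Aconf]; exists (Assessment (posi (acc A)) (L `\` posi (acc A))).
  split; first by apply: cone_maximal_model => //; exact: posi_cone.
  split => /=; first exact: sub_posi.
  move=> f Arf; split; first exact: ArL.
  by move=> pf; suff: set0 f by []; rewrite -Aconf.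
move=> [M [[[_ Mconf [_ ME] _] _] [AMa AMr]]].
have posiM : posi (acc A) `<=` acc M by rewrite -ME; exact: posi_mono.
have disjM f : acc M f -> rej A f -> False.
  by move=> Mf /AMr Mrf; suff: set0 f by []; rewrite -Mconf.
split; apply/seteqP; split => // f [/= Af Arf]; apply: (disjM f) => //.
  exact: AMa.
exact: posiM.
Qed.
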